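(* Let $\Delta=(N_1,\dots,N_l)$ be a partition of $n$ with $N_1\le\dots\le N_l\le p$, let $z\in M(d,n;\mathbb{F}_q)$ and let $\chi$ be a character of $H_\Delta$. Then $$N(X_{\Delta,z};\chi)=\Phi_\Delta(\chi;z).$$
   Context: $q$ is a power of a prime $p$, $N=q-1$, $\psi$ a fixed nontrivial additive character of $\mathbb{F}_q$, $\psi_a(x)=\psi(ax)$; multiplicative characters satisfy $\alpha(0)=0$. For $m\ge1$ let $\Lambda$ be the $m\times m$ matrix with $1$'s on the superdiagonal and $0$ elsewhere, $[h_0,\dots,h_{m-1}]=\sum_i h_i\Lambda^i$, $J(m)=\{[h_0,\dots,h_{m-1}]:h_0\in\mathbb{F}_q^*,h_i\in\mathbb{F}_q\}$. For $x=(x_0,x_1,\dots)$, $X_j=x_j/x_0$, let $\theta_i(x)=\sum_{k_1+2k_2+\dots+ik_i=i,\,k_j\ge0}(-1)^{k_1+\dots+k_i-1}\frac{(k_1+\dots+k_i-1)!}{k_1!\cdots k_i!}X_1^{k_1}\cdots X_i^{k_i}$, $\overline\theta_i(x)=x_0^i\theta_i(x)$ (a polynomial in $x_0,\dots,x_i$), and $\theta_i([h_0,\dots,h_{m-1}])=\theta_i(h_0,\dots,h_i)$. $H_\Delta=\{\mathrm{diag}(h_1,\dots,h_l):h_i\in J(N_i)\}$; the map $\widetilde\iota(\mathrm{diag}(h_i))=(h_{i,0},\theta_1(h_i),\dots,\theta_{N_i-1}(h_i))_i$ is an isomorphism $H_\Delta\to G_\Delta:=\prod_{i=1}^l(\mathbb{F}_q^*\times\mathbb{F}_q^{N_i-1})$,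 and characters of $H_\Delta$ are $\chi=\chi'\circ\widetilde\iota$ with $\chi'$ a character of $G_\Delta$. Write $z=(z^{(1)},\dots,z^{(l)})$, $z^{(i)}=(z^{(i)}_0,\dots,z^{(i)}_{N_i-1})$ consecutive column blocks. For $s\in\mathbb{F}_q^d$ (row), $\chi_i(sz^{(i)})=\chi_i([sz^{(i)}_0,\dots,sz^{(i)}_{N_i-1}])$ if $sz^{(i)}_0\ne0$ and $0$ otherwise, $\chi(sz)=\prod_i\chi_i(sz^{(i)})$, $\Phi_\Delta(\chi;z)=\sum_{s\in\mathbb{F}_q^d}\chi(sz)$. $X_{\Delta,z}\subset\mathbb{A}^{n+d}$ is the affine variety over $\mathbb{F}_q$ in coordinates $t_i$ ($1\le i\le l$), $u_{(i,j)}$ ($1\le i\le l$, $1\le j\le N_i-1$), $s=(s_1,\dots,s_d)$, defined by $t_i^N=sz_0^{(i)}$, $t_i^{Nj}(u_{(i,j)}^q-u_{(i,j)})=\overline\theta_j(sz^{(i)})$ for $1\le j\le N_i-1$, and $t_i\ne0$, for all $i$. $G_\Delta$ acts on $X_{\Delta,z}$ by $(\xi_i,a_{(i,j)})\cdot(t_i,u_{(i,j)},s)=(\xi_it_i,u_{(i,j)}+a_{(i,j)},s)$, and $H_\Delta$ acts through $\widetilde\iota$. For a variety $X$ over $\mathbb{F}_q$ with an action of a finite abelian group $G$ and a character $\chi$ of $G$, $N(X;\chi)=\frac1{\#G}\sum_{g\in G}\chi(g)\Lambda_g$ with $\Lambda_g=\#\{P\in X(\overline{\mathbb{F}}_q):\mathrm{Frob}(P)=g\cdot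 P\}$, $\mathrm{Frob}$ the $q$-Frobenius. *)

(* Defs.v *)
From HB Require Import structures.
From mathcomp Require Import all_boot all_order all_algebra all_field.
From mathcomp Require Import finmap boolp classical_sets cardinality.

Set Implicit Arguments.
Unset Strict Implicit.
Unset Printing Implicit Defensive.

Import GRing.Theory.
Local Open Scope ring_scope.

(* Matrix entries with natural-number indices starting at 0, and value 0 out
   of range; [fun j => entry A 0 j] is the sequence of entries of the first
   row of [A]. *)
Definition entry (R : nmodType) (m n : nat) (A : 'M[R]_(m, n)) (i j : nat) : R :=
  if insub i is Some i' then if insub j is Some j' then A i' j' else 0 else 0.

Definition shift_mx (R : pzRingType) (m : nat) : 'M[R]_m :=
  \matrix_(i, j) (j == i.+1 :> nat)%:R.

(* [h_0, ..., h_(m-1)] *)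
Definition toep (R : pzRingType) (m : nat) (h : nat -> R) : 'M[R]_m :=
  \sum_(i < m) h i *: shift_mx R m ^+ i.

Definition J (F : finFieldType) (m : nat) : {set 'M[F]_m} :=
  [set toep m (entry h 0) | h : 'rV[F]_m & entry h 0 0 != 0].

(* [k j : 'I_i.+1] is the exponent k_(j+1) of X_(j+1); the weight condition
   forces all exponents to be at most i.  The quotient of integers is taken
   in R, where the denominators are invertible as soon as i < char R. *)
Definition theta (R : fieldType) (i : nat) (x : nat -> R) : R :=
  \sum_(k : {ffun 'I_i -> 'I_i.+1} | (\sum_(j < i) j.+1 * k j == i)%N)
    (-1) ^+ (\sum_(j < i) k j).-1
    * (((\sum_(j < i) k j).-1)`!%:R / (\prod_(j < i) (k j)`!)%:R)
    * \prod_(j < i) (x j.+1 / x 0%N) ^+ k j.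

(* As in [theta], x 0 is inverted: this agrees with the polynomial where
   x 0 != 0, and on [XDelta] below x 0 = t ^ N is nonzero. *)
Definition theta_bar (R : fieldType) (i : nat) (x : nat -> R) : R :=
  x 0%N ^+ i * theta i x.

(* N(X; chi) for a finite group G acting on the set X of geometric points of
   a variety with Frobenius map Frob. *)
Definition twisted_points (T gT : Type) (X : set T) (Frob : T -> T)
    (act : gT -> T -> T) (g : gT) : set T :=
  [set P | X P /\ Frob P = act g P]%classic.

Definition twisted_count (T : choiceType) (gT : finType) (X : set T)
    (Frob : T -> T) (G : {set gT}) (act : gT -> T -> T) (chi : gT -> algC)
    : algC :=
  #|G|%:R^-1 *
  \sum_(g in G) chi g * #|` fset_set (twisted_points X Frob act g)|%:R.

Section Delta.

Variables (F : finFieldType) (l : nat) (Delta : 'I_l -> nat).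

Local Notation n := (\sum_i Delta i)%N.

Definition HDelta : {set 'M[F]_n} :=
  [set \mxdiag_i h i
  | h : {dffun forall i, 'M[F]_(Delta i)} in setXn (fun i => J F (Delta i))].

Definition is_char_HDelta (chi : 'M[F]_n -> algC) : Prop :=
  chi 1%:M = 1 /\ {in HDelta &, {morph chi : g h / g *m h >-> g * h}}.

(* The underlying type of G_Delta = prod_i (F^* x F^(Delta i - 1)): the first
   component is the family of the F^*-coordinates, the second one is cut into
   consecutive blocks of lengths Delta i - 1.  Index j : 'I_(Delta i).-1 of
   block i stands for the pair (i, j + 1). *)
Definition GDeltaT := ('rV[F]_l * 'rV[F]_(\sum_i (Delta i).-1))%type.

Definition iotat (h : 'M[F]_n) : GDeltaT :=
  (\row_i entry (submxblock h i i) 0 0,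
   \mxrow_i \row_(j < (Delta i).-1) theta j.+1 (entry (submxblock h i i) 0)).

(* chi_i, as a character of J(Delta i) *)
Definition char_block (chi : 'M[F]_n -> algC) (i : 'I_l) (h : 'M[F]_(Delta i))
    : algC :=
  chi (\mxdiag_k dfwith (fun k => 1%:M : 'M[F]_(Delta k)) h k).

(* The sequence (s z^(i)_0, s z^(i)_1, ...). *)
Definition block_seq (R : pzRingType) (d : nat) (s : 'rV[R]_d)
    (z : 'M[R]_(d, n)) (i : 'I_l) : nat -> R :=
  entry (s *m submxrow z i) 0.

Definition char_at (chi : 'M[F]_n -> algC) (d : nat) (s : 'rV[F]_d)
    (z : 'M[F]_(d, n)) : algC :=
  \prod_i (let x := block_seq s z i in
           if x 0%N != 0 then char_block chi (toep (Delta i) x) else 0).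

Definition Phi (chi : 'M[F]_n -> algC) (d : nat) (z : 'M[F]_(d, n)) : algC :=
  \sum_(s : 'rV[F]_d) char_at chi s z.

Variables (K : fieldType) (f : {rmorphism F -> K}).

(* Affine space of dimension l + sum_i (Delta i - 1) + d, with coordinates
   (t, u, s); the blocks of u are indexed as for [GDeltaT]. *)
Definition ptT (d : nat) : choiceType :=
  ('rV[K]_l * 'rV[K]_(\sum_i (Delta i).-1) * 'rV[K]_d)%type.

Definition XDelta (d : nat) (z : 'M[F]_(d, n)) : set (ptT d) :=
  [set P : ptT d | let: (t, u, s) := P in
    forall i : 'I_l,
      let x := block_seq s (map_mx f z) i in
      [/\ t 0 i ^+ #|F|.-1 = x 0%N,
          forall j : 'I_(Delta i).-1,
            t 0 i ^+ (#|F|.-1 * j.+1)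
              * (submxrow u i 0 j ^+ #|F| - submxrow u i 0 j)
            = theta_bar j.+1 x
        & t 0 i != 0]]%classic.

Definition FrobP (d : nat) (P : ptT d) : ptT d :=
  let: (t, u, s) := P in
  let Fr a := a ^+ #|F| in
  (map_mx Fr t, map_mx Fr u, map_mx Fr s).

Definition actG (d : nat) (g : GDeltaT) (P : ptT d) : ptT d :=
  let: (t, u, s) := P in
  (\row_i (f (g.1 0 i) * t 0 i), u + map_mx f g.2, s).

Definition actH (d : nat) (h : 'M[F]_n) (P : ptT d) : ptT d :=
  actG (iotat h) P.

Definition NX (d : nat) (z : 'M[F]_(d, n)) (chi : 'M[F]_n -> algC) : algC :=
  twisted_count (XDelta z) (@FrobP d) HDelta (@actH d) chi.

End Delta.

(* [fset_set] sends infinite sets to the empty one; the sets counted in [NX]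
   are finite. *)
Lemma finite_twisted_points (F : finFieldType) (l : nat) (Delta : 'I_l -> nat)
    (K : closedFieldType) (f : {rmorphism F -> K}) (d : nat)
    (z : 'M[F]_(d, \sum_i Delta i)) (h : 'M[F]_(\sum_i Delta i)) :
  finite_set (twisted_points (XDelta f z) (@FrobP F l Delta K d)
                (@actH F l Delta K f d) h).
Proof.
pose q := #|F|.
have q_gt1 : (1 < q)%N by exact: finNzRing_gt1.
pose pol (cb : F * F) : {poly K} := 'X^q - (f cb.1 *: 'X + (f cb.2)%:P).
have pol_neq0 cb : pol cb != 0.
  have sz : (size (f cb.1 *: 'X + (f cb.2)%:P)%R <= 2)%N.
    apply: leq_trans (size_polyD _ _) _; rewrite geq_max.
    rewrite (leq_trans (size_scale_leq _ _)) ?size_polyX //=.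
    by rewrite (leq_trans (size_polyC_leq1 _)).
  rewrite -size_poly_eq0 /pol size_polyDl ?size_polyXn //.
  by rewrite size_polyN (leq_ltn_trans sz).
have roots cb : exists r : seq K, forall a, root (pol cb) a -> a \in r.
  have [r Er] := closed_field_poly_normal (pol cb).
  exists r => a; rewrite Er rootZ ?lead_coef_eq0 //.
  by rewrite root_prod_XsubC.
have [r Hr] := choice roots.
pose S := flatten [seq r cb | cb <- enum {: F * F}].
have inS (a : K) (c b : F) : a ^+ q = f c * a + f b -> a \in S.
  move=> Ea; apply/flattenP; exists (r (c, b)).
    by apply: map_f; rewrite mem_enum.
  by apply: Hr; rewrite /root /pol !hornerE Ea subrr.
have fin m : finite_set [set v : 'rV[K]_m | forall j, v 0 j \in S]%classic.
  pose g (w : 'rV[seq_sub S]_m) := map_mx val w.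
  apply: (@sub_finite_set _ _ [set g w | w in [set: _]]%classic).
    move=> v /= vS; exists (\row_j SeqSub (vS j)) => //.
    by apply/rowP => j; rewrite !mxE.
  exact/finite_image/finite_finset.
apply: sub_finite_set (finite_setX (finite_setX (fin l) (fin _)) (fin d)).
move=> [[t u] s] /= [_ [Et Eu Es]]; split; [split|] => j /=.
- move/rowP/(_ j): Et; rewrite !mxE => Et.
  by apply: (inS _ (entry (submxblock h j j) 0 0) 0); rewrite Et rmorph0 addr0.
- move/rowP/(_ j): Eu; rewrite !mxE => Eu.
  by apply: (inS _ 1 ((iotat h).2 0 j)); rewrite Eu rmorph1 mul1r !mxE.
- move/rowP/(_ j): Es; rewrite !mxE => Es.
  by apply: (inS _ 1 0); rewrite Es rmorph0 addr0 rmorph1 mul1r.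
Qed.

(* Main.v *)
(** A point (t, u, s) of X_(Delta, z) satisfies Frob P = h P iff s is rational
    over F_q and, for every block i, t_i^(q-1) = h_(i,0) = s z^(i)_0 and
    u_(i,j)^q - u_(i,j) = theta_j(h_i) = theta_j(s z^(i)).  Since theta_j is
    X_j plus a polynomial in X_1, ..., X_(j-1), the conditions on s say
    that h is the block-diagonal matrix with blocks [s z^(i)].  Over each such
    s the solutions (t, u) form a torsor under G_Delta, so Lambda_h is #G_Delta
    times the number of these s; as #H_Delta = #G_Delta, averaging against chi
    leaves the sum of chi(s z) over the s with all s z^(i)_0 nonzero.  That
    theta defines a morphism is never needed, only its injectivity. *)

Require Import Defs.
From mathcomp Require Import all_boot all_order all_algebra all_field.
From mathcomp Require Import finmap boolp classical_sets cardinality.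

Set Implicit Arguments.
Unset Strict Implicit.
Unset Printing Implicit Defensive.

Import GRing.Theory.
Local Open Scope ring_scope.

(** * Block matrices and Toeplitz blocks *)

Lemma mul_mxdiag (R : pzSemiRingType) (p : nat) (p_ : 'I_p -> nat)
    (A B : forall i, 'M[R]_(p_ i)) :
  \mxdiag_i A i *m \mxdiag_i B i = \mxdiag_i (A i *m B i).
Proof.
rewrite [X in _ *m X]/mxdiag mul_mxdiag_mxblock.
apply: eq_mxblock => i j; case: eqP => [e|_]; last by rewrite mulmx0.
by case: _ / e; rewrite !conform_mx_id.
Qed.

Lemma map_submxrow (aT rT : Type) (g : aT -> rT) (m q : nat) (q_ : 'I_q -> nat)
    (A : 'M[aT]_(m, \sum_i q_ i)) (j : 'I_q) :
  submxrow (map_mx g A) j = map_mx g (submxrow A j).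
Proof. by apply/matrixP => a b; rewrite !mxE. Qed.

Lemma submxrowP (T : Type) (m q : nat) (q_ : 'I_q -> nat)
    (A B : 'M[T]_(m, \sum_i q_ i)) :
  (forall j, submxrow A j = submxrow B j) -> A = B.
Proof.
by move=> eAB; rewrite -[A]submxrowK -[B]submxrowK; apply: eq_mxrow.
Qed.

Lemma map_entry (R S : nmodType) (g : {additive R -> S}) (m n : nat)
    (A : 'M[R]_(m, n)) (i j : nat) :
  entry (map_mx g A) i j = g (entry A i j).
Proof.
rewrite /entry; case: insub => [i'|]; last by rewrite raddf0.
by case: insub => [j'|]; rewrite ?raddf0 ?mxE.
Qed.

Lemma entryE (R : nmodType) (m n : nat) (A : 'M[R]_(m, n)) (i : 'I_m)
  (j : 'I_n) : entry A i j = A i j.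
Proof. by rewrite /entry !insubT // => ? ?; congr (A _ _); apply: val_inj. Qed.

Lemma shift_mxX (R : pzRingType) (m k : nat) (i j : 'I_m) :
  (shift_mx R m ^+ k) i j = (j == i + k :> nat)%N%:R.
Proof.
elim: k i j => [|k IHk] i j.
  by rewrite expr0 addn0 [1]/(1%:M) mxE eq_sym.
rewrite exprS -mulmxE mxE; under eq_bigr do rewrite IHk mxE.
(* Row [i] of the shift has its only 1 in column [i.+1]. The last row is zero, and there the
   right-hand side vanishes too because [j < m]. *)
have [lt_im|le_mi] := ltnP i.+1 m.
  rewrite (bigD1 (Ordinal lt_im)) //= eqxx mul1r big1 ?addr0 ?addSnnS //.
  move=> a; rewrite -val_eqE /= => /negbTE neq.
  by rewrite neq mul0r.
rewrite big1 => [|a _]; last first.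
  by rewrite ltn_eqF ?mul0r // (leq_trans (ltn_ord a)).
rewrite ltn_eqF // (leq_trans (ltn_ord j)) // addnS (leq_trans le_mi) //.
by rewrite ltnS leq_addr.
Qed.

Lemma toepE (R : pzRingType) (m : nat) (x : nat -> R) (i j : 'I_m) :
  toep m x i j = if (i <= j)%N then x (j - i)%N else 0.
Proof.
rewrite summxE; under eq_bigr do rewrite mxE shift_mxX.
have [le_ij|lt_ji] := leqP i j; last first.
  by apply: big1 => k _; rewrite ltn_eqF ?mulr0 // ltn_addr.
have lt_m : (j - i < m)%N by rewrite (leq_ltn_trans (leq_subr _ _)).
rewrite (bigD1 (Ordinal lt_m)) //= subnKC // eqxx mulr1 big1 ?addr0 // => k.
rewrite -val_eqE /= => neq.
have -> : (j == i + k :> nat)%N = false; last exact: mulr0.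
by apply: contraNF neq => /eqP ->; rewrite addKn.
Qed.

Lemma entry_toep (R : pzRingType) (m : nat) (x : nat -> R) (j : nat) :
  (j < m)%N -> entry (toep m x) 0 j = x j.
Proof.
move=> lt_jm; have m_gt0 : (0 < m)%N by apply: leq_trans lt_jm.
by rewrite (entryE _ (Ordinal m_gt0) (Ordinal lt_jm)) toepE /= subn0.
Qed.

Lemma eq_toep (R : pzRingType) (m : nat) (x y : nat -> R) :
  (forall j, (j < m)%N -> x j = y j) -> toep m x = toep m y.
Proof. by move=> exy; apply: eq_bigr => j _; rewrite exy. Qed.

Lemma toep_inj (R : pzRingType) (m : nat) (x y : nat -> R) (j : nat) :
  toep m x = toep m y -> (j < m)%N -> x j = y j.
Proof. by move=> exy lt_jm; rewrite -(entry_toep x lt_jm) exy entry_toep. Qed.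

Lemma toep1 (R : pzRingType) (m : nat) :
  toep m (fun j => (j == 0)%N%:R) = 1%:M :> 'M[R]_m.
Proof.
apply/matrixP => i j; rewrite toepE mxE -val_eqE /=.
by rewrite subn_eq0 eqn_leq; case: leqP.
Qed.

(** The sequence [x] is free from index [m] on, so infinite sequences such as [block_seq s z i]
    serve untruncated. For [m = 0] the equivalence fails: [entry h 0 0] defaults to 0, so [J F 0] is
    empty. *)
Lemma J_P (F : finFieldType) (m : nat) (A : 'M[F]_m) : (0 < m)%N ->
  reflect (exists2 x, x 0%N != 0 & A = toep m x) (A \in J F m).
Proof.
move=> m_gt0; apply: (iffP imsetP) => [[h]|[x x0 ->]].
  by rewrite inE => h0 ->; exists (entry h 0).
have ex j : (j < m)%N -> entry (\row_(k < m) x k) 0 j = x j.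
  by move=> lt_jm; rewrite (entryE _ ord0 (Ordinal lt_jm)) mxE.
by exists (\row_(j < m) x j); rewrite ?inE ?ex //; apply: eq_toep => j /ex.
Qed.

(** * The functions theta_i and their injectivity *)

Lemma eq_theta (R : fieldType) (i : nat) (x y : nat -> R) :
  (forall j, (j <= i)%N -> x j = y j) -> theta i x = theta i y.
Proof.
move=> exy; rewrite /theta; apply: eq_bigr => k _; congr (_ * _).
by apply: eq_bigr => j _; rewrite !exy.
Qed.

Lemma map_theta (R S : fieldType) (f : {rmorphism R -> S}) (i : nat)
    (x : nat -> R) :
  theta i (fun j => f (x j)) = f (theta i x).
Proof.
rewrite /theta rmorph_sum; apply: eq_bigr => k _.
rewrite !rmorphM rmorphXn rmorphN1 fmorphV !rmorph_nat.
congr (_ * _); rewrite rmorph_prod; apply: eq_bigr => j _.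
by rewrite rmorphXn fmorph_div.
Qed.

(* The only monomial of weight i + 1 that involves X_(i+1) is X_(i+1) itself,
   and its coefficient is 1. *)
Lemma theta_triangular (R : fieldType) (i : nat) (x y : nat -> R) :
  (forall j, (j <= i)%N -> x j = y j) ->
  theta i.+1 x - x i.+1 / x 0%N = theta i.+1 y - y i.+1 / y 0%N.
Proof.
move=> exy.
pose k0 : {ffun 'I_i.+1 -> 'I_i.+2} :=
  [ffun j => if j == ord_max then inord 1 else ord0].
have k0m : k0 ord_max = 1%N :> nat by rewrite ffunE eqxx inordK.
have k0n (j : 'I_i.+1) : j != ord_max -> k0 j = 0%N :> nat.
  by rewrite ffunE => /negbTE ->.
have sum_k0 : (\sum_(j < i.+1) k0 j = 1)%N.
  by rewrite (bigD1 ord_max) //= k0m big1.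
have wt_k0 : (\sum_(j < i.+1) j.+1 * k0 j == i.+1)%N.
  rewrite (bigD1 ord_max) //= k0m muln1 big1 ?addn0 // => j /k0n ->.
  by rewrite muln0.
have prod_k0 : (\prod_(j < i.+1) (k0 j)`! = 1)%N.
  by apply: big1 => j _; rewrite ffunE; case: ifP => _; rewrite ?inordK.
have mono (w : nat -> R) : \prod_(j < i.+1) (w j.+1 / w 0%N) ^+ k0 j
                           = w i.+1 / w 0%N.
  rewrite (bigD1 ord_max) //= k0m expr1 big1 ?mulr1 // => j /k0n ->.
  exact: expr0.
have thetaE (w : nat -> R) : theta i.+1 w - w i.+1 / w 0%N =
  \sum_(k : {ffun 'I_i.+1 -> 'I_i.+2} |
      (\sum_(j < i.+1) j.+1 * k j == i.+1)%N && (k != k0))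
    (-1) ^+ (\sum_(j < i.+1) k j).-1
    * (((\sum_(j < i.+1) k j).-1)`!%:R / (\prod_(j < i.+1) (k j)`!)%:R)
    * \prod_(j < i.+1) (w j.+1 / w 0%N) ^+ k j.
  rewrite /theta (bigD1 k0) //= sum_k0 prod_k0 mono expr0 fact0 divr1 !mul1r.
  by rewrite addrAC subrr add0r.
rewrite !thetaE; apply: eq_bigr => k /andP[/eqP wt_k neq_k].
suff km : k ord_max = 0%N :> nat.
  congr (_ * _); apply: eq_bigr => j _; have [->|neq_j] := eqVneq j ord_max.
    by rewrite km !expr0.
  rewrite !exy // ltn_neqAle -ltnS ltn_ord andbT.
  by apply: contra neq_j => /eqP ej; apply/eqP/val_inj.
(* A positive exponent of X_(i+1) already uses up the whole weight i + 1, which forces [k = k0]. *)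
apply/eqP; apply: contraNT neq_k; rewrite -lt0n => km_gt0.
move: wt_k; rewrite (bigD1 ord_max) //= => wt_k.
have km : k ord_max = 1%N :> nat.
  apply/eqP; rewrite eqn_leq km_gt0 andbT -(leq_pmul2l (ltn0Sn i)) muln1.
  by rewrite -[X in (_ <= X)%N]wt_k leq_addr.
move: wt_k; rewrite km muln1 -[X in _ = X]addn0 => /addnI/eqP.
rewrite sum_nat_eq0 => /forallP kn.
apply/eqP/ffunP => j; apply: val_inj => /=.
have [->|neq_j] := eqVneq j ord_max; first by rewrite km k0m.
by move: (kn j); rewrite neq_j muln_eq0 /= k0n // => /eqP.
Qed.

(** Strong induction: once the earlier terms agree, [theta_triangular] leaves x_(j+1) / x_0 =
    y_(j+1) / y_0, and the common x_0 is nonzero. *)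
Lemma theta_inj (R : fieldType) (m : nat) (x y : nat -> R) :
  x 0%N != 0 -> x 0%N = y 0%N ->
  (forall j, (j < m)%N -> theta j.+1 x = theta j.+1 y) ->
  forall j, (j <= m)%N -> x j = y j.
Proof.
move=> x0 e0 exy j; elim/ltn_ind: j => -[|j] // IHj lt_jm.
have /theta_triangular : forall k, (k <= j)%N -> x k = y k.
  by move=> k le_kj; apply: IHj => //; apply: ltnW (leq_ltn_trans le_kj lt_jm).
rewrite exy // -e0 => /addrI/oppr_inj/mulIf; apply.
by rewrite invr_eq0.
Qed.

Lemma map_block_seq (R S : pzRingType) (g : {rmorphism R -> S}) (l : nat)
    (Delta : 'I_l -> nat) (d : nat) (s : 'rV[R]_d)
    (z : 'M[R]_(d, \sum_i Delta i)) (i : 'I_l) (j : nat) :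
  block_seq (map_mx g s) (map_mx g z) i j = g (block_seq s z i j).
Proof. by rewrite /block_seq map_submxrow -map_mxM map_entry. Qed.

(** * Frobenius-fixed elements and equations over a closed field *)

Section FrobeniusFixed.

Variables (F : finFieldType) (K : fieldType) (f : {rmorphism F -> K}).

Lemma map_expf_card (a : F) : f a ^+ #|F| = f a.
Proof. by rewrite -rmorphXn expf_card. Qed.

(** Over [F] the polynomial X^q - X is the product of all X - b, so its image under [f] has only the
    roots [f b]. *)
Lemma expf_cardP (a : K) : a ^+ #|F| = a -> exists b, a = f b.
Proof.
move=> ea; have : ('X^#|F| - 'X).[a] == 0 by rewrite !hornerE ea subrr.
have -> : 'X^#|F| - 'X = map_poly f ('X^#|F| - 'X).
  by rewrite rmorphB /= map_polyXn map_polyX.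
rewrite finField_genPoly rmorph_prod horner_prod prodf_seq_eq0 => /hasP[b _].
by rewrite /= map_polyXsubC hornerXsubC subr_eq0 => /eqP; exists b.
Qed.

(** [K] inherits the characteristic p of [F], and q is a power of p: iterate the p-Frobenius. *)
Lemma expf_cardB (a b : K) : (a - b) ^+ #|F| = a ^+ #|F| - b ^+ #|F|.
Proof.
have [p pr_p pF] := finPcharP F; have pK := rmorph_pchar f pF.
rewrite (card_pprimeChar pF); move: (logn _ _) => k.
elim: k a b => [|k IHk] a b; rewrite ?expr1 // expnSr !exprM IHk.
by rewrite -!(pFrobenius_autE pK) rmorphB.
Qed.

End FrobeniusFixed.

Lemma card_pred_gt0 (F : finFieldType) : (0 < #|F|.-1)%N.
Proof. by rewrite -ltnS prednK ?finNzRing_gt1 // ltnW ?finNzRing_gt1. Qed.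

Lemma closed_nth_root (K : closedFieldType) (n : nat) (c : K) :
  (0 < n)%N -> exists t, t ^+ n = c.
Proof.
move=> n_gt0.
(* [solve_monicpoly] solves x^n = P(x) with deg P < n; here P is the constant [c]. *)
have [x Ex] := @solve_monicpoly K n (fun i => if i is 0 then c else 0) n_gt0.
exists x; rewrite Ex; case: n n_gt0 {Ex} => // n _.
by rewrite big_ord_recl expr0 mulr1 big1 ?addr0 // => i _; rewrite mul0r.
Qed.

Lemma closed_artin_schreier (K : closedFieldType) (n : nat) (c : K) :
  (1 < n)%N -> exists u, u ^+ n = u + c.
Proof.
(* Here P = X + c, of degree below n since [1 < n]. *)
move=> n_gt1; have [x Ex] := @solve_monicpoly K n
  (fun i => if i is 0 then c else (i == 1)%N%:R) (ltnW n_gt1).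
exists x; rewrite Ex; case: n n_gt1 {Ex} => // -[|n] // _.
rewrite big_ord_recl big_ord_recl expr0 mulr1 mul1r expr1 big1 => [|i _].
  by rewrite addr0 addrC.
by rewrite mul0r.
Qed.

(** * Coordinates on H_Delta and factorisation of its characters *)

Section TwistedCount.

Variables (F : finFieldType) (l : nat) (Delta : 'I_l -> nat).
Hypothesis Delta_gt0 : forall i, (0 < Delta i)%N.

(** Sequences give the elements of H_Delta and the matrices built from s z a common form; terms of
    [x i] from index [Delta i] on are ignored. *)
Definition diag_toep (x : 'I_l -> nat -> F) : 'M[F]_(\sum_i Delta i) :=
  \mxdiag_i toep (Delta i) (x i).

Lemma eq_diag_toep (x y : 'I_l -> nat -> F) :
  (forall i j, (j < Delta i)%N -> x i j = y i j) -> diag_toep x = diag_toep y.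
Proof. by move=> exy; apply: eq_mxdiag => i; apply/eq_toep/exy. Qed.

Lemma diag_toep_inj (x y : 'I_l -> nat -> F) (i : 'I_l) (j : nat) :
  diag_toep x = diag_toep y -> (j < Delta i)%N -> x i j = y i j.
Proof. by rewrite /diag_toep => /eq_mxdiagP/(_ i)/toep_inj; apply. Qed.

Lemma HDeltaP (h : 'M[F]_(\sum_i Delta i)) :
  reflect (exists2 x, (forall i, x i 0%N != 0) & h = diag_toep x)
          (h \in HDelta F Delta).
Proof.
apply: (iffP imsetP) => [[B /setXnP BJ ->]|[x x0 ->]].
  have /choice[x xP] : forall i, exists x,
      x 0%N != 0 /\ B i = toep (Delta i) x.
    by move=> i; have /(J_P _ (Delta_gt0 i))[x x0 Ex] := BJ i; exists x.
  exists x => [i|]; first by have [] := xP i.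
  by apply: eq_mxdiag => i; have [] := xP i.
exists [ffun i => toep (Delta i) (x i)] => /=.
  by apply/setXnP => i; rewrite ffunE; apply/J_P => //; exists (x i).
by apply: eq_mxdiag => i; rewrite ffunE.
Qed.

Lemma iotat_diag_toep (x : 'I_l -> nat -> F) :
  iotat (diag_toep x) =
  (\row_i x i 0%N, \mxrow_i \row_(j < (Delta i).-1) theta j.+1 (x i)).
Proof.
rewrite /iotat; congr (_, _).
  by apply/rowP => i; rewrite !mxE submxblock_diag entry_toep.
apply: eq_mxrow => i; apply/rowP => j; rewrite !mxE submxblock_diag.
(* theta_(j+1) reads indices up to j + 1, which is still below [Delta i]. *)
apply: eq_theta => k le_kj; apply: entry_toep.
by rewrite (leq_ltn_trans le_kj) // -[X in (_ < X)%N]prednK // ltnS.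
Qed.

Definition GDelta : {set GDeltaT F Delta} :=
  finset.setX [set a : 'rV[F]_l | [forall i, a 0 i != 0]] [set: _].

Lemma card_GDelta_gt0 : (0 < #|GDelta|)%N.
Proof.
apply/card_gt0P; exists (const_mx 1, 0); rewrite !inE andbT.
by apply/forallP => i; rewrite mxE oner_neq0.
Qed.

(** The bijection takes the coordinates of G_Delta as the Toeplitz entries themselves, without
    passing through theta. *)
Lemma card_HDelta : #|HDelta F Delta| = #|GDelta|.
Proof.
pose x (g : GDeltaT F Delta) (i : 'I_l) (j : nat) :=
  if j is k.+1 then entry (submxrow g.2 i) 0 k else g.1 0 i.
have pos i (j : 'I_(Delta i).-1) : (j.+1 < Delta i)%N.
  by rewrite -[X in (_ < X)%N]prednK // ltnS.
have x_inj : injective (diag_toep \o x).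
  move=> [a u] [b v] exy; congr (_, _).
    by apply/rowP => i; apply: (diag_toep_inj (j := 0) exy).
  apply: submxrowP => i; apply/rowP => j.
  have := diag_toep_inj exy (pos i j).
  by rewrite /= !(entryE _ ord0).
rewrite -(card_imset (mem GDelta) x_inj); apply: eq_card => h.
apply/HDeltaP/imsetP => [[y y0 ->]|[[a u]]].
  exists (\row_i y i 0%N, \mxrow_i \row_(j < (Delta i).-1) y i j.+1).
    by rewrite !inE andbT; apply/forallP => i; rewrite mxE.
  apply: eq_diag_toep => i [|j] lt_j; rewrite /= ?mxE //.
  have lt_j' : (j < (Delta i).-1)%N by rewrite -ltnS prednK.
  by rewrite (entryE _ ord0 (Ordinal lt_j')) mxrowK mxE.
rewrite !inE andbT => /forallP /= a0 ->.
by exists (x (a, u)).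
Qed.

(** A block-diagonal matrix is the product of matrices with a single nontrivial block. The induction
    fills in the blocks one at a time: [y r] has identity blocks outside [r], since [e] is the
    sequence of the identity. *)
Lemma char_diag_toep (chi : 'M[F]_(\sum_i Delta i) -> algC)
    (x : 'I_l -> nat -> F) :
  is_char_HDelta chi -> (forall i, x i 0%N != 0) ->
  chi (diag_toep x) = \prod_i char_block chi (toep (Delta i) (x i)).
Proof.
move=> [chi1 chiM] x0.
pose e j : F := (j == 0)%N%:R.
pose y (r : seq 'I_l) i := if i \in r then x i else e.
have e0 : e 0%N != 0 by rewrite oner_neq0.
have y0 r i : y r i 0%N != 0 by rewrite /y; case: ifP.
have single i : \mxdiag_k dfwith (fun k => 1%:M : 'M[F]_(Delta k))
    (toep (Delta i) (x i)) k = diag_toep (y [:: i]).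
  apply: eq_mxdiag => k; rewrite /y inE; case: dfwithP => [|j neq_ij].
    by rewrite eqxx.
  by rewrite eq_sym (negbTE neq_ij) toep1.
have H r : diag_toep (y r) \in HDelta F Delta by apply/HDeltaP; exists (y r).
suff chi_y r : uniq r -> chi (diag_toep (y r)) =
    \prod_(i <- r) char_block chi (toep (Delta i) (x i)).
  rewrite -(chi_y _ (index_enum_uniq _)); congr chi.
  by apply: eq_diag_toep => i j _; rewrite /y mem_index_enum.
elim: r => [_|i r IHr /= /andP[i_notin uniq_r]].
  rewrite big_nil -[RHS]chi1 -mxdiagZ; congr chi.
  by apply: eq_mxdiag => i; apply: toep1.
rewrite big_cons -IHr // /char_block single -chiM //; congr chi.
(* As [i] is not in [r], in every block at least one factor is the identity. *)
rewrite mul_mxdiag; apply: eq_mxdiag => k; rewrite /y !inE.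
have [->|_] := eqVneq k i; first by rewrite (negbTE i_notin) toep1 mulmx1.
by rewrite [toep _ e]toep1 mul1mx.
Qed.

(** * Twisted points as a torsor over each fibre *)

Section Torsor.

Variables (K : closedFieldType) (f : {rmorphism F -> K}).
Variables (d : nat) (z : 'M[F]_(d, \sum_i Delta i)).

Definition fibre (h : 'M[F]_(\sum_i Delta i)) : {set 'rV[F]_d} :=
  [set s | [forall i, block_seq s z i 0%N != 0]
           && (diag_toep (block_seq s z) == h)].

(* Over a point s of the fibre, t and u are the roots of t^(q-1) = h_0 and
   u^q - u = theta(h): a torsor under G_Delta, which does not depend on s. *)
Lemma card_twisted_points (h : 'M[F]_(\sum_i Delta i)) :
  h \in HDelta F Delta ->
  #|` fset_set (twisted_points (XDelta f z) (@FrobP F l Delta K d)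
                  (@actH F l Delta K f d) h)| = (#|GDelta| * #|fibre h|)%N.
Proof.
case/HDeltaP=> x x0 def_h.
have q_gt1 : (1 < #|F|)%N := finNzRing_gt1 F.
have expq (a : K) : a ^+ #|F| = a ^+ #|F|.-1 * a.
  by rewrite -exprSr prednK // ltnW.
have /choice[t0 Et0] : forall i, exists t : K, t ^+ #|F|.-1 = f (x i 0%N).
  by move=> i; apply: closed_nth_root (card_pred_gt0 F).
have t0_neq0 i : t0 i != 0.
  by have := x0 i; rewrite -(fmorph_eq0 f) -Et0 expf_eq0 card_pred_gt0.
pose c : 'rV[F]_(\sum_i (Delta i).-1) :=
  \mxrow_i \row_(j < (Delta i).-1) theta j.+1 (x i).
have /choice[u0 Eu0] : forall k, exists u : K, u ^+ #|F| = u + f (c 0 k).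
  by move=> k; apply: closed_artin_schreier.
(* Translates of the base point [(t0, u0)], placed over a rational [s]. Restricted to [GDelta] times
   [fibre h], this is the bijection that gives the count. *)
pose pt (gs : GDeltaT F Delta * 'rV[F]_d) : ptT Delta K d :=
  (\row_i (t0 i * f (gs.1.1 0 i)), \row_k (u0 k + f (gs.1.2 0 k)),
   map_mx f gs.2).
have pt_inj : injective pt.
  move=> [[a b] s] [[a' b'] s'] [/rowP ea /rowP eb /rowP es].
  congr (_, _, _); apply/rowP => i.
  - by have := ea i; rewrite !mxE => /(mulfI (t0_neq0 i))/fmorph_inj.
  - by have := eb i; rewrite !mxE => /addrI/fmorph_inj.
  - by have := es i; rewrite !mxE => /fmorph_inj.
have iota_h : iotat h = (\row_i x i 0%N, c) by rewrite def_h iotat_diag_toep.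
have cE i (j : 'I_(Delta i).-1) : submxrow c i 0 j = theta j.+1 (x i).
  by rewrite mxrowK mxE.
have blockE (s : 'rV[F]_d) i : block_seq (map_mx f s) (map_mx f z) i
    = fun j => f (block_seq s z i j).
  by apply: funext => j; apply: map_block_seq.
have memP P : P \in fset_set (twisted_points (XDelta f z)
      (@FrobP F l Delta K d) (@actH F l Delta K f d) h)
    = (P \in map pt (enum (finset.setX GDelta (fibre h)))).
  rewrite in_fset_set; last exact: finite_twisted_points.
  case: P => [[t u] s]; apply/idP/mapP; rewrite inE.
    case=> XP; rewrite /actH iota_h => -[/rowP Et /rowP Eu /rowP Es].
    have /choice[s' Es'] : forall j, exists b, s 0 j = f b.
      by move=> j; apply: expf_cardP; have := Es j; rewrite mxE.
    have {Es}def_s : s = map_mx f (\row_j s' j).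
      by apply/rowP => j; rewrite !mxE.
    have t_neq0 i : t 0 i != 0 by have [] := XP i.
    have tN i : t 0 i ^+ #|F|.-1 = f (x i 0%N).
      by have := Et i; rewrite !mxE expq => /(mulIf (t_neq0 i)).
    have uq k : u 0 k ^+ #|F| = u 0 k + f (c 0 k).
      by have := Eu k; rewrite !mxE.
    (* The ratio of two (q-1)-th roots of the same nonzero element is fixed by Frobenius, hence lies
       in the image of [F]; so does the difference of two solutions of one Artin-Schreier
       equation. *)
    have /choice[a Ea] : forall i, exists b, t 0 i / t0 i = f b.
      move=> i; apply: expf_cardP; rewrite expq expr_div_n tN Et0.
      by rewrite divff ?mul1r // fmorph_eq0.
    have /choice[b Eb] : forall k, exists b, u 0 k - u0 k = f b.
      move=> k; apply: expf_cardP; rewrite (expf_cardB f) uq Eu0.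
      by rewrite opprD addrACA subrr addr0.
    exists ((\row_i a i, \row_k b k), \row_j s' j); last first.
      congr (_, _, _) => //; apply/rowP => i; rewrite !mxE.
        by rewrite -Ea mulrC divfK.
      by rewrite -Eb addrC subrK.
    rewrite mem_enum !inE /= andbT; apply/and3P; split.
    - apply/forallP => i; rewrite mxE -(fmorph_eq0 f) -Ea.
      by rewrite mulf_neq0 ?invr_eq0.
    - apply/forallP => i; have [+ _ _] := XP i.
      by rewrite def_s blockE tN => /fmorph_inj <-.
    (* Frobenius gives u^q - u = theta(h), while the equations of [XDelta], after cancelling powers
       of t^(q-1) = h_0, give u^q - u = theta(s z^(i)). Injectivity of theta then recovers the
       entries. *)
    apply/eqP; rewrite def_h; apply: eq_diag_toep => i j lt_j; apply/esym.
    have := XP i; rewrite def_s blockE tN => -[/fmorph_inj e0 eth _].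
    apply: (@theta_inj _ (Delta i).-1) => // [k lt_k|]; last first.
      by rewrite -ltnS prednK.
    have := eth (Ordinal lt_k); rewrite /theta_bar map_theta exprM tN /=.
    rewrite -e0 => /(mulfI _); rewrite expf_neq0 ?fmorph_eq0 // => /(_ isT).
    have -> : submxrow u i 0 (Ordinal lt_k) ^+ #|F|
        = submxrow u i 0 (Ordinal lt_k) + f (submxrow c i 0 (Ordinal lt_k)).
      by rewrite ![submxrow _ _ _ _]mxE uq.
    by rewrite cE addrC addKr => /fmorph_inj.
  (* Conversely, a^(q-1) = 1 and b^q = b for a nonzero and b arbitrary in [F], so translates satisfy
     the equations of the base point. *)
  case=> [[[a b] s']]; rewrite mem_enum !inE /= andbT.
  move=> /and3P[/forallP a0 /forallP y0 /eqP Ey] [-> -> ->].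
  have Ex i j : (j < Delta i)%N -> block_seq s' z i j = x i j.
    by apply: diag_toep_inj; rewrite Ey.
  have a_unit i : f (a 0 i) ^+ #|F|.-1 = 1.
    have fa0 : f (a 0 i) != 0 by rewrite fmorph_eq0.
    by apply: (mulIf fa0); rewrite -expq map_expf_card mul1r.
  have tN i : (t0 i * f (a 0 i)) ^+ #|F|.-1 = f (x i 0%N).
    by rewrite exprMn Et0 a_unit mulr1.
  have uq k : (u0 k + f (b 0 k)) ^+ #|F| = u0 k + f (b 0 k) + f (c 0 k).
    rewrite -[f (b 0 k)]opprK -rmorphN (expf_cardB f) Eu0 map_expf_card.
    by rewrite addrAC.
  split.
    move=> i /=; rewrite blockE !mxE tN Ex //; split=> // [j|].
      rewrite exprM tN /theta_bar map_theta Ex //; congr (_ * _).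
      have -> : theta j.+1 (block_seq s' z i) = theta j.+1 (x i).
        apply: eq_theta => k le_kj; apply: Ex; rewrite (leq_ltn_trans le_kj) //.
        by rewrite -[X in (_ < X)%N]prednK // ltnS.
      rewrite -cE ![submxrow _ _ _ _]mxE [X in X ^+ _]mxE uq.
      by rewrite [X in _ - X]mxE addrAC subrr add0r.
    by rewrite mulf_neq0 ?fmorph_eq0.
  rewrite /actH iota_h; congr (_, _, _); apply/rowP => i; rewrite !mxE.
  - by rewrite expq tN.
  - by rewrite uq !mxE.
  - exact: map_expf_card.
rewrite -cardsX cardE -(size_map pt); apply: perm_size.
apply: uniq_perm; [exact: fset_uniq | | exact: memP].
by rewrite map_inj_uniq ?enum_uniq.
Qed.

End Torsor.
End TwistedCount.

Theorem theorem4p4 (F : finFieldType) (p : nat) (hp : p \in [pchar F])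
  (* K, via f, is an algebraic closure of F *)
  (K : closedFieldType) (f : {rmorphism F -> K}) (hK : integralRange f)
  (l : nat) (Delta : 'I_l -> nat)
  (Delta_gt0 : forall i, (0 < Delta i)%N)
  (Delta_sorted : forall i j : 'I_l, (i <= j)%N -> (Delta i <= Delta j)%N)
  (Delta_le_p : forall i, (Delta i <= p)%N)
  (d : nat) (z : 'M[F]_(d, \sum_i Delta i))
  (chi : 'M[F]_(\sum_i Delta i) -> algC) (hchi : is_char_HDelta chi) :
  NX f z chi = Phi chi z.
Proof.
pose good (s : 'rV[F]_d) := [forall i, block_seq s z i 0%N != 0].
(* If some s z^(i)_0 is zero, the corresponding factor kills the term. *)
have -> : Phi chi z = \sum_(s | good s) chi (diag_toep Delta (block_seq s z)).
  rewrite /Phi (bigID good) /= [X in _ + X]big1 ?addr0 => [|s].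
    apply: eq_bigr => s /forallP s0; rewrite (char_diag_toep Delta_gt0 hchi) //.
    by apply: eq_bigr => i _; rewrite /= s0.
  case/forallPn => i /negPn /eqP s0.
  by rewrite /char_at (bigD1 i) //= s0 eqxx mul0r.
have inH s : good s -> diag_toep Delta (block_seq s z) \in HDelta F Delta.
  by move/forallP => s0; apply/(HDeltaP Delta_gt0); exists (block_seq s z).
(* Grouping the good [s] by the matrix they define yields the sets [fibre h]; the factor #G_Delta in
   each twisted count cancels 1 / #H_Delta. *)
rewrite (partition_big _ _ inH) /NX /twisted_count mulr_sumr.
apply: eq_bigr => h Hh; rewrite card_twisted_points // card_HDelta // natrM.
have G0 : #|GDelta F Delta|%:R != 0 :> algC.
  by rewrite Num.Theory.pnatr_eq0 -lt0n card_GDelta_gt0.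
rewrite mulrCA mulKf // -sum1_card natr_sum mulr_sumr.
apply: eq_big => [s|s]; rewrite inE // => /andP[_ /eqP ->].
by rewrite mulr1.
Qed.
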